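(* Let $n,m,p$ be positive integers, let $\mathcal{A}:\mathbb{S}^{n\times n}\to\mathbb{R}^m$ be a linear map and $b\in\mathbb{R}^m$. Assume that (1) the set $\mathcal{C}=\{X\in\mathbb{S}^{n\times n}:\mathcal{A}(X)=b,\ X\succeq 0\}$ is compact; (2) $(\mathcal{A},b)$ is $p$-regular. If $\frac{p(p+1)}{2}+p>m$, then for almost all (with respect to Lebesgue measure) cost matrices $C\in\mathbb{S}^{n\times n}$ the following holds: if $V\in\mathcal{M}_p$ is a second-order critical point of the problem (Factorized SDP) with cost matrix $C$, then - $V$ is a global minimizer of (Factorized SDP), and - $X=VV^T$ is a global minimizer of (SDP).
   Context: $\mathbb{S}^{n\times n}$ is the space of real symmetric $n\times n$ matrices; $\langle M_1,M_2\rangle=\mathrm{Tr}(M_1^TM_2)$. For a cost matrix $C\in\mathbb{S}^{n\times n}$: (SDP): minimize $\langle C,X\rangle$ over $X\in\mathcal{C}=\{X\in\mathbb{S}^{n\times n}:\mathcal{A}(X)=b,X\succeq0\}$. (Factorized SDP), the rank $p$ Burer-Monteiro factorization: minimize $f_C(V)=\langle C,VV^T\rangle$ over $V\in\mathcal{M}_p=\{V\in\mathbb{R}^{n\times p}:\mathcal{A}(VV^T)=b\}$. $(\mathcal{A},b)$ is $p$-regular if for all $V\in\mathcal{M}_p$ the linear map $\dot V\in\mathbb{R}^{n\times p}\mapsto\mathcal{A}(V\dot V^T+\dot VV^T)\in\mathbb{R}^m$ is surjective. In that case $\mathcal{M}_p$ is a submanifold of $\mathbb{R}^{n\times p}$ of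 dimension $np-m$, with tangent space $T_V\mathcal{M}_p=\{\dot V\in\mathbb{R}^{n\times p}:\mathcal{A}(V\dot V^T+\dot VV^T)=0\}$, equipped with the Riemannian metric induced by $\langle\cdot,\cdot\rangle$. $V\in\mathcal{M}_p$ is a second-order critical point of (Factorized SDP) if the Riemannian gradient and Hessian of $f_C:\mathcal{M}_p\to\mathbb{R}$ satisfy $\nabla f_C(V)=0$ and $\mathrm{Hess}f_C(V)\succeq0$. *)

(* Defs.v *)
From HB Require Import structures.
From mathcomp Require Import all_boot all_order all_algebra.
From mathcomp Require Import all_classical all_reals all_analysis.
Set Implicit Arguments.
Unset Strict Implicit.
Unset Printing Implicit Defensive.
Import Order.TTheory GRing.Theory Num.Theory.
Import numFieldNormedType.Exports.
Local Open Scope classical_set_scope.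
Local Open Scope ring_scope.

Section SymmetricMatrices.
Variables (R : realType) (n : nat).

Definition is_symmx : {pred 'M[R]_n} := fun M => M^T == M.

Fact is_symmx_submod : submod_closed is_symmx.
Proof.
split=> [|a M N]; first by rewrite unfold_in trmx0.
by rewrite !unfold_in linearD linearZ /= => /eqP-> /eqP->.
Qed.

HB.instance Definition _ :=
  GRing.isSubmodClosed.Build R 'M[R]_n is_symmx is_symmx_submod.

Record symmx := Symmx { symval :> 'M[R]_n; _ : symval \in is_symmx }.

HB.instance Definition _ := [isSub for symval].
HB.instance Definition _ := [Choice of symmx by <:].
HB.instance Definition _ := [SubChoice_isSubZmodule of symmx by <:].
HB.instance Definition _ := [SubZmodule_isSubLmodule of symmx by <:].

(* Lebesgue outer measure on the space of symmetric matrices, read in the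
   n(n+1)/2 coordinates X i j with i <= j.  The Lebesgue measure associated
   with the trace inner product is a positive multiple of this one, hence has
   the same null sets. *)
Definition sym_box (l u : symmx) : set symmx :=
  [set X : symmx | forall i j, l i j <= X i j <= u i j].

Definition sym_box_volume (l u : symmx) : R :=
  \prod_(i < n) \prod_(j < n | (i <= j)%N) (u i j - l i j).

Definition sym_outer_lebesgue (E : set symmx) : \bar R :=
  ereal_inf [set (\sum_(0 <= k <oo) (sym_box_volume (B k).1 (B k).2)%:E)%E
            | B in [set B : nat -> symmx * symmx |
                (forall k i j, (B k).1 i j <= (B k).2 i j) /\
                E `<=` \bigcup_k sym_box (B k).1 (B k).2]].

Definition almost_all_symmx (P : symmx -> Prop) : Prop :=
  sym_outer_lebesgue [set C | ~ P C] = 0%E.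

End SymmetricMatrices.

Section SymmetricProducts.
Variables (R : realType) (n p : nat).

Fact gram_subproof (V : 'M[R]_(n, p)) : V *m V^T \in @is_symmx R n.
Proof. by rewrite unfold_in trmx_mul trmxK. Qed.

Definition gram (V : 'M[R]_(n, p)) : symmx R n := Symmx (gram_subproof V).

Fact dgram_subproof (V U : 'M[R]_(n, p)) :
  V *m U^T + U *m V^T \in @is_symmx R n.
Proof. by rewrite unfold_in linearD /= !trmx_mul !trmxK addrC. Qed.

Definition dgram (V U : 'M[R]_(n, p)) : symmx R n := Symmx (dgram_subproof V U).

End SymmetricProducts.

Definition frob (R : realType) (n p : nat) (M N : 'M[R]_(n, p)) : R :=
  \tr (M^T *m N).

Definition psdmx (R : realType) (n : nat) (X : 'M[R]_n) : Prop :=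
  forall x : 'cV[R]_n, 0 <= (x^T *m X *m x) 0 0.

Definition global_minimizer (R : realType) (T : Type) (f : T -> R)
    (F : set T) (x : T) : Prop :=
  F x /\ forall y, F y -> f x <= f y.

(* Riemannian submanifold of the Euclidean space of n x p matrices, given by
   its tangent spaces T V.  The family T is also defined for V off the
   submanifold, so that [rgrad T f] is a vector field on the ambient space; it
   is a smooth extension of the Riemannian gradient as soon as V |-> T V is
   smooth and of constant rank near the submanifold. *)
Section RiemannianSubmanifold.
Variables (R : realType) (n p : nat).
Local Notation E := 'M[R]_(n, p).
Implicit Types (T : E -> set E) (f : E -> R).

Definition orth_proj (S : set E) (X : E) : E :=
  xget 0 [set Y | S Y /\ forall U, S U -> frob (X - Y) U = 0].

Definition rgrad T f (V : E) : E :=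
  xget 0 [set G | T V G /\ forall U, T V U -> frob G U = 'D_U f V].

(* The Levi-Civita connection of a submanifold of a Euclidean space: ambient
   directional derivative followed by projection on the tangent space. *)
Definition rhess T f (V U : E) : E :=
  orth_proj (T V) ('D_U (rgrad T f) V).

End RiemannianSubmanifold.

Section BurerMonteiro.
Variables (R : realType) (n m : nat).
Variables (A : {linear symmx R n -> 'cV[R]_m}) (b : 'cV[R]_m).

Definition sdp_feasible : set (symmx R n) := [set X | A X = b /\ psdmx X].

Definition sdp_cost (C X : symmx R n) : R := frob C X.

Definition bm_feasible (p : nat) : set 'M[R]_(n, p) := [set V | A (gram V) = b].

Definition bm_cost (p : nat) (C : symmx R n) (V : 'M[R]_(n, p)) : R :=
  frob C (gram V).

Definition p_regular (p : nat) : Prop :=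
  forall V : 'M[R]_(n, p), bm_feasible V ->
  forall y : 'cV[R]_m, exists U : 'M[R]_(n, p), A (dgram V U) = y.

(* Under p-regularity V |-> A (dgram V _) stays surjective near the feasible
   set, so these kernels have constant dimension and vary smoothly there. *)
Definition bm_tangent (p : nat) (V : 'M[R]_(n, p)) : set 'M[R]_(n, p) :=
  [set U | A (dgram V U) = 0].

Definition second_order_critical (p : nat) (C : symmx R n)
    (V : 'M[R]_(n, p)) : Prop :=
  [/\ bm_feasible V,
      rgrad (@bm_tangent p) (@bm_cost p C) V = 0 &
      forall U, bm_tangent V U ->
        0 <= frob U (rhess (@bm_tangent p) (@bm_cost p C) V U)].

End BurerMonteiro.

(* Main.v *)
Require Import Defs.
From mathcomp Require Import all_boot all_order all_algebra.
From mathcomp Require Import all_classical all_reals all_analysis.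
From mathcomp Require Import ring lra.
Set Implicit Arguments.
Unset Strict Implicit.
Unset Printing Implicit Defensive.
Import Order.TTheory GRing.Theory Num.Theory.
Import numFieldNormedType.Exports.
Local Open Scope classical_set_scope.
Local Open Scope ring_scope.

(** Let [V] be a second-order critical point for the cost [C].  The multiplier
    [y] of [V] gives a slack matrix [S = C - A^*(y)] with [S V = 0], and the
    Riemannian Hessian at a tangent vector [U] is [2 <U, S U>].  If [S] is
    positive semidefinite, then [V V^T] is optimal by weak duality
    ([psd_slack_optimal]).  So it must be shown that for almost every [C] no
    critical point has [z^T S z < 0] for some [z].

    Suppose it has.  On vectors [V M + z w] the form [<U, S U>] is
    [(z^T S z) |w| ^ 2], so a tangent vector of this form has [w = 0].  Applied
    to [z w] with [V w^T = 0], this shows that [V] has full column rank.  Lower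
    triangular [M] and arbitrary [w] make up [p (p + 1) / 2 + p > m] unknowns,
    so that some nonzero [V M + z w] is tangent; there [w = 0], and
    [H = V (M + M^T) V^T] is a nonzero element of the kernel of [A]
    ([indefinite_slack_direction]).  All the matrices
    [X_s = V V^T + s H = V (1 + s (M + M^T)) V^T] satisfy [A X_s = b] and
    [S X_s = 0]: the cost [C] has a whole segment of stationary points of the
    semidefinite program, the sign of [S] being left aside.

    It remains to see that the costs with such a segment form a null set
    ([complementary_segment_null]).  This is a case of Sard's theorem, obtained
    here by a Lipschitz argument.  If [A X = A X' = b], [S X = 0] and
    [S' X' = 0], then

      [<X - X', C - C'> = <X - X', S - S'> = - <X, S'> - <X', S>],

    and [S' X' = 0] gives [<X, S'> = <S', (X - X') Y (X - X')>] for a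
    generalized inverse [Y] of [X].  As long as the slacks and the generalized
    inverses stay bounded, the left-hand side is therefore at most
    [K |X - X'| ^ 2] in absolute value.  For [t > 2 K] this makes [X], and
    hence [C], a Lipschitz function of [t X - C] ([complementary_lipschitz]).  A
    segment of stationary points of [C] is mapped by [X |-> t X - C] to a
    segment along which some coordinate varies, and so takes a rational value.
    The costs in question are thus covered by countably many Lipschitz images
    of bounded subsets of hyperplanes of the space of symmetric matrices, and
    such images are null ([lipschitz_hyperplane_null]).

    The Hessian is computed in [second_order_critical_slack]: along a line
    through [V] the Riemannian gradient is a rational function, by Cramer's
    rule for the multipliers, and the derivative of the multipliers only
    contributes a normal vector, which is orthogonal to the tangent space. *)

(** * The trace inner product *)

Section Frobenius.
Variable R : realType.

Lemma frobE n p (M N : 'M[R]_(n, p)) :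
  frob M N = \sum_i \sum_j M i j * N i j.
Proof.
rewrite /frob /mxtrace exchange_big /=; apply: eq_bigr => j _.
by rewrite mxE; apply: eq_bigr => i _; rewrite mxE.
Qed.

Lemma frobC n p (M N : 'M[R]_(n, p)) : frob M N = frob N M.
Proof. by rewrite /frob -mxtrace_tr trmx_mul trmxK. Qed.

Lemma frobDl n p (M N P : 'M[R]_(n, p)) : frob (M + N) P = frob M P + frob N P.
Proof. by rewrite /frob linearD /= mulmxDl mxtraceD. Qed.

Lemma frobZl n p a (M P : 'M[R]_(n, p)) : frob (a *: M) P = a * frob M P.
Proof. by rewrite /frob linearZ /= -scalemxAl mxtraceZ. Qed.

Lemma frobNl n p (M P : 'M[R]_(n, p)) : frob (- M) P = - frob M P.
Proof. by rewrite -scaleN1r frobZl mulN1r. Qed.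

Lemma frobBl n p (M N P : 'M[R]_(n, p)) : frob (M - N) P = frob M P - frob N P.
Proof. by rewrite frobDl frobNl. Qed.

Lemma frobDr n p (M N P : 'M[R]_(n, p)) : frob P (M + N) = frob P M + frob P N.
Proof. by rewrite !(frobC P) frobDl. Qed.

Lemma frobZr n p a (M P : 'M[R]_(n, p)) : frob P (a *: M) = a * frob P M.
Proof. by rewrite !(frobC P) frobZl. Qed.

Lemma frobNr n p (M P : 'M[R]_(n, p)) : frob P (- M) = - frob P M.
Proof. by rewrite !(frobC P) frobNl. Qed.

Lemma frobBr n p (M N P : 'M[R]_(n, p)) : frob P (M - N) = frob P M - frob P N.
Proof. by rewrite frobDr frobNr. Qed.

Lemma frob0r n p (M : 'M[R]_(n, p)) : frob M 0 = 0.
Proof. by rewrite /frob mulmx0 mxtrace0. Qed.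

Lemma frob0l n p (M : 'M[R]_(n, p)) : frob 0 M = 0.
Proof. by rewrite frobC frob0r. Qed.

Lemma frob_sumr n p (I : finType) (F : I -> 'M[R]_(n, p)) M :
  frob M (\sum_i F i) = \sum_i frob M (F i).
Proof. by rewrite /frob mulmx_sumr raddf_sum. Qed.

Lemma frob_ge0 n p (M : 'M[R]_(n, p)) : 0 <= frob M M.
Proof.
by rewrite frobE sumr_ge0// => i _; rewrite sumr_ge0// => j _; rewrite -expr2 sqr_ge0.
Qed.

Lemma sqr_entry_le_frob n p (M : 'M[R]_(n, p)) i j : M i j ^+ 2 <= frob M M.
Proof.
rewrite frobE (bigD1 i)//= (bigD1 j)//= -expr2 -addrA lerDl addr_ge0 ?sumr_ge0//.
  by move=> k _; rewrite -expr2 sqr_ge0.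
by move=> k _; rewrite sumr_ge0// => l _; rewrite -expr2 sqr_ge0.
Qed.

Lemma frob_eq0 n p (M : 'M[R]_(n, p)) : frob M M = 0 -> M = 0.
Proof.
move=> M0; apply/matrixP => i j; rewrite mxE; apply/eqP.
by rewrite -sqrf_eq0 eq_le sqr_ge0 -[X in _ <= X]M0 sqr_entry_le_frob.
Qed.

Lemma frob_delta q r (M : 'M[R]_(q, r)) i j : frob M (delta_mx i j) = M i j.
Proof.
rewrite frobE (bigD1 i)//= (bigD1 j)//= mxE !eqxx mulr1.
rewrite big1 => [|k /negPf kj]; last by rewrite mxE kj andbF mulr0.
rewrite big1 ?addr0// => k /negPf ki; rewrite big1// => l _.
by rewrite mxE ki mulr0.
Qed.

Lemma frob_mull n p q (M : 'M[R]_(n, p)) (N : 'M[R]_(p, q)) P :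
  frob (M *m N) P = frob N (M^T *m P).
Proof. by rewrite /frob trmx_mul mulmxA. Qed.

Lemma frob_mulr n p q (M : 'M[R]_(n, p)) (N : 'M[R]_(p, q)) P :
  frob (M *m N) P = frob M (P *m N^T).
Proof. by rewrite /frob trmx_mul -mulmxA mxtrace_mulC !mulmxA. Qed.

Lemma symmx_tr n (C : symmx R n) : (symval C)^T = C.
Proof. by case: C => C /= /eqP. Qed.

Lemma symmx_addE n (X Y : symmx R n) : symval (X + Y) = symval X + symval Y.
Proof. by []. Qed.

Lemma symmx_subE n (X Y : symmx R n) : symval (X - Y) = symval X - symval Y.
Proof. by []. Qed.

Lemma symmx_scaleE n a (X : symmx R n) : symval (a *: X) = a *: symval X.
Proof. by []. Qed.

Lemma symmx_sumE n I (r : seq I) P (F : I -> symmx R n) :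
  symval (\sum_(i <- r | P i) F i) = \sum_(i <- r | P i) symval (F i).
Proof. by elim/big_ind2: _ => // x1 x2 y1 y2 <- <-. Qed.

Lemma symmx_entryC n (C : symmx R n) i j : C i j = C j i.
Proof. by rewrite -{1}symmx_tr mxE. Qed.

Lemma frob_symmx_gram n p (C : symmx R n) (V U : 'M[R]_(n, p)) :
  frob C (U *m V^T) = frob (symval C *m V) U.
Proof. by rewrite frobC frob_mulr trmxK frobC. Qed.

Lemma frob_symmx_mul n p (C : symmx R n) (V U : 'M[R]_(n, p)) :
  frob (symval C *m V) U = frob V (symval C *m U).
Proof. by rewrite frob_mull symmx_tr. Qed.

(** Half of this is the gradient of [V |-> <C, V V^T>]: symmetry of [C] merges
    the two halves of the differential of [V |-> V V^T]. *)
Lemma frob_dgram n p (C : symmx R n) (V U : 'M[R]_(n, p)) :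
  frob C (dgram V U) = 2 * frob (symval C *m V) U.
Proof.
rewrite /= frobDr !frob_symmx_gram frob_symmx_mul frobC -mulr2n mulr_natl.
by rewrite frob_symmx_mul frobC frob_symmx_mul.
Qed.

Lemma dgramD n p (V U G : 'M[R]_(n, p)) : dgram V (U + G) = dgram V U + dgram V G.
Proof. by apply: val_inj; rewrite /= linearD /= mulmxDr mulmxDl addrACA. Qed.

Lemma dgramZ n p a (V U : 'M[R]_(n, p)) : dgram V (a *: U) = a *: dgram V U.
Proof.
by apply: val_inj; rewrite /= linearZ /= scalerDr -scalemxAr -scalemxAl.
Qed.

Lemma dgram_sum n p (V : 'M[R]_(n, p)) (I : finType) (F : I -> 'M[R]_(n, p)) :
  dgram V (\sum_i F i) = \sum_i dgram V (F i).
Proof.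
elim/big_ind2: _ => [|? U1 ? U2 <- <-|//]; last exact: dgramD.
by rewrite -[X in dgram V X](scale0r V) dgramZ scale0r.
Qed.

Definition bounded_entries p q (k : R) (M : 'M[R]_(p, q)) : Prop :=
  forall i j, `|M i j| <= k.

Lemma normr_sum_le_const p (F : 'I_p -> R) c :
  (forall i, `|F i| <= c) -> `|\sum_i F i| <= p%:R * c.
Proof.
move=> Fc; apply: le_trans (ler_norm_sum _ _ _) _.
by rewrite mulr_natl -[p in X in _ <= X]card_ord -sumr_const; apply: ler_sum.
Qed.

Lemma entries_bounded_by_frob q r (M : 'M[R]_(q, r)) : bounded_entries (frob M M + 1) M.
Proof.
move=> i j; have := sqr_entry_le_frob M i j; have := frob_ge0 M.
rewrite -real_normK ?num_real//; have := normr_ge0 (M i j).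
by move: `|_| (frob _ _) => x f; nra.
Qed.

Lemma frob_entries_le p q (M : 'M[R]_(p, q)) d :
  (forall i j, `|M i j| <= d) -> frob M M <= p%:R * (q%:R * d ^+ 2).
Proof.
move=> Md; rewrite frobE (le_trans (ler_norm _))//.
apply: normr_sum_le_const => i; apply: normr_sum_le_const => j.
by rewrite normrM expr2 ler_pM.
Qed.

End Frobenius.

(** * The adjoint of the constraint map *)

Section Adjoint.
Variables (R : realType) (n m : nat) (A : {linear symmx R n -> 'cV[R]_m}).

Fact symdelta_subproof i j :
  2^-1 *: (delta_mx i j + delta_mx j i) \in @is_symmx R n.
Proof. by rewrite unfold_in linearZ /= linearD /= !trmx_delta addrC. Qed.

(** These matrices span the symmetric ones with redundancy, as [symdelta i j]
    and [symdelta j i] coincide: the entries [X i j] are coordinates without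
    any restriction to [i <= j]. *)
Definition symdelta i j : symmx R n := Symmx (symdelta_subproof i j).

Lemma symmx_sum_delta (X : symmx R n) : X = \sum_i \sum_j X i j *: symdelta i j.
Proof.
apply: val_inj; rewrite /= symmx_sumE.
transitivity (2^-1 *: (symval X + (symval X)^T)).
  rewrite symmx_tr -mulr2n -[symval X *+ 2]scaler_nat scalerA mulVf.
    by rewrite scale1r.
  by rewrite pnatr_eq0.
rewrite [X in _ + X^T]matrix_sum_delta {1}[symval X]matrix_sum_delta.
rewrite linear_sum /= -big_split /= scaler_sumr; apply: eq_bigr => i _.
rewrite linear_sum /= -big_split /= scaler_sumr symmx_sumE; apply: eq_bigr => j _.
by rewrite linearZ /= trmx_delta -scalerDr !scalerA mulrC.
Qed.

Lemma adj_subproof (y : 'cV[R]_m) :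
  \matrix_(i, j) (y^T *m A (symdelta i j)) 0 0 \in @is_symmx R n.
Proof.
rewrite unfold_in; apply/eqP/matrixP => i j; rewrite !mxE.
suff -> : symdelta i j = symdelta j i by [].
by apply: val_inj; rewrite /= addrC.
Qed.

Definition adj y : symmx R n := Symmx (adj_subproof y).

Lemma frob_adj y (X : symmx R n) : frob (adj y) X = (y^T *m A X) 0 0.
Proof.
rewrite {2}[X]symmx_sum_delta linear_sum /= mulmx_sumr summxE frobE.
apply: eq_bigr => i _; rewrite linear_sum /= mulmx_sumr summxE.
by apply: eq_bigr => j _; rewrite linearZ /= -scalemxAr !mxE mulrC.
Qed.

Lemma adjE y i j : adj y i j = \sum_k y k 0 * A (symdelta i j) k 0.
Proof. by rewrite mxE mxE; apply: eq_bigr => k _; rewrite mxE. Qed.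

Lemma adj_sum y : symval (adj y) = \sum_i y i 0 *: symval (adj (delta_mx i 0)).
Proof.
apply/matrixP => a c; rewrite summxE adjE.
apply: eq_bigr => i _; rewrite mxE adjE; congr (_ * _).
rewrite (bigD1 i)//= !mxE !eqxx mul1r big1 ?addr0// => k /negPf ki.
by rewrite !mxE ki mul0r.
Qed.

Lemma frob_adj_delta i (X : symmx R n) : frob (adj (delta_mx i 0)) X = A X i 0.
Proof.
rewrite frob_adj mxE (bigD1 i)//= !mxE !eqxx mul1r big1 ?addr0// => k /negPf ki.
by rewrite !mxE ki mul0r.
Qed.

(** If [A (dgram V U) = y], then [|y| ^ 2 = <adj y, dgram V U>], which is
    [2 <adj y V, U> = 0]: regularity is the injectivity of [y |-> adj y V]. *)
Lemma adj_mul_eq0 p (V : 'M[R]_(n, p)) y :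
  (forall z, exists U : 'M[R]_(n, p), A (dgram V U) = z) ->
  symval (adj y) *m V = 0 -> y = 0.
Proof.
move=> surj yV0; apply: frob_eq0; have [U AU] := surj y.
have := frob_adj y (dgram V U).
by rewrite frob_dgram yV0 frob0l mulr0 AU /frob trace_mx11.
Qed.

End Adjoint.

(** * Positive semidefinite matrices *)

Section Psd.
Variable R : realType.

Lemma psd_gram n p (V : 'M[R]_(n, p)) : psdmx (gram V).
Proof.
move=> x; rewrite /= mulmxA -mulmxA -{1}[V]trmxK -trmx_mul.
by rewrite -trace_mx11 frob_ge0.
Qed.

(** Induction by Schur complements.  A vanishing pivot forces its whole column
    [v] to vanish, so that one formula, with [0^-1 = 0], serves for all pivots. *)
Lemma psd_factor n (X : 'M[R]_n) : X^T = X -> psdmx X ->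
  exists W : 'M[R]_n, X = W *m W^T.
Proof.
elim: n X => [|n IH] X sX pX; first by exists 0; apply/matrixP => -[].
rewrite -[n.+1]/(1 + n)%N in X sX pX *.
pose a := X 0 0; pose v : 'cV[R]_n := dlsubmx X; pose Y := drsubmx X.
have EX : X = block_mx a%:M v^T v Y.
  rewrite -[LHS]submxK; congr block_mx; last by rewrite -[in LHS]sX trmx_dlsub.
  by apply/matrixP => i j; rewrite !ord1 !mxE; congr (X _ _); apply/val_inj.
have pq t (y : 'cV[R]_n) :
    0 <= a * t ^+ 2 + 2 * t * (v^T *m y) 0 0 + (y^T *m Y *m y) 0 0.
  have vy : v^T *m y = ((v^T *m y) 0 0)%:M by exact: mx11_scalar.
  have Yy : y^T *m Y *m y = ((y^T *m Y *m y) 0 0)%:M by exact: mx11_scalar.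
  move: (_ 0 0) ((y^T *m Y *m y) 0 0) vy Yy => s q vy Yy.
  have := pX (col_mx t%:M y); rewrite {1}EX tr_col_mx tr_scalar_mx.
  rewrite mul_row_block mul_row_col !mulmxDl -[in y^T *m v](trmxK v) -trmx_mul.
  rewrite -(mulmxA t%:M v^T) vy Yy tr_scalar_mx -!scalar_mxM -!raddfD /= mxE mulr1n.
  by congr (0 <= _); ring.
have a_ge0 : 0 <= a.
  by have := pq 1 0; rewrite trmx0 mul0mx !mulmx0 !mxE mulr0 !addr0 expr1n mulr1.
have v_eq0 : a = 0 -> v = 0.
  move=> a0; apply: frob_eq0; rewrite /frob trace_mx11.
  apply/eqP; apply: contraT => s0.
  (* Without the quadratic term in [t], the form takes the value [-1]. *)
  have := pq (- ((v^T *m Y *m v) 0 0 + 1) / (2 * (v^T *m v) 0 0)) v.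
  move: s0; move: (_ 0 0) ((v^T *m Y *m v) 0 0) => s q s0.
  have -> : a * (- (q + 1) / (2 * s)) ^+ 2 + 2 * (- (q + 1) / (2 * s)) * s + q = -1.
    by rewrite a0; field.
  by rewrite ler0N1.
have [W EW] : exists W : 'M[R]_n, Y - a^-1 *: (v *m v^T) = W *m W^T.
  apply: IH.
    have sY : Y^T = Y by rewrite /Y trmx_drsub sX.
    by rewrite linearB linearZ /= trmx_mul trmxK sY.
  move=> y; have := pq (- (a^-1 * (v^T *m y) 0 0)) y.
  have vy : v^T *m y = ((v^T *m y) 0 0)%:M by exact: mx11_scalar.
  have Yy : y^T *m Y *m y = ((y^T *m Y *m y) 0 0)%:M by exact: mx11_scalar.
  have -> : y^T *m (Y - a^-1 *: (v *m v^T)) *m y =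
      y^T *m Y *m y - a^-1 *: ((v^T *m y)^T *m (v^T *m y)).
    by rewrite mulmxBr mulmxBl -scalemxAr -scalemxAl trmx_mul trmxK !mulmxA.
  move: (_ 0 0) ((y^T *m Y *m y) 0 0) vy Yy => s q -> ->.
  rewrite tr_scalar_mx -scalar_mxM !mxE !mulr1n.
  by congr (0 <= _); have [->|a0] := eqVneq a 0; [rewrite invr0; ring | field].
exists (block_mx (Num.sqrt a)%:M 0 ((Num.sqrt a)^-1 *: v) W).
rewrite tr_block_mx mulmx_block !trmx0 !mul0mx !mulmx0 !addr0 tr_scalar_mx.
rewrite linearZ /= -scalar_mxM -expr2 sqr_sqrtr// mul_scalar_mx mul_mx_scalar !scalerA.
have sv : (Num.sqrt a * (Num.sqrt a)^-1) *: v = v.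
  have [/v_eq0 ->|a0] := eqVneq a 0; first by rewrite scaler0.
  by rewrite mulfV ?scale1r// sqrtr_eq0 -ltNge lt_def a0.
rewrite -scalemxAl -scalemxAr scalerA -expr2 exprVn sqr_sqrtr// -EW.
have := congr1 trmx sv; rewrite linearZ /= => svT.
by rewrite [in RHS]addrC subrK svT sv {1}EX.
Qed.

(** With [X = W W^T] this is a sum of values of the form [S] at the columns
    of [W]. *)
Lemma frob_psd_ge0 n (S X : symmx R n) : psdmx S -> psdmx X -> 0 <= frob S X.
Proof.
move=> pS /(psd_factor (symmx_tr X))[W ->]; rewrite frob_symmx_gram frobC.
rewrite /frob /mxtrace sumr_ge0// => i _.
have := pS (col i W); congr (0 <= _).
by rewrite -mulmxA !mxE; apply: eq_bigr => k _; rewrite !mxE; congr (_ * _);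
  apply: eq_bigr => l _; rewrite !mxE.
Qed.

End Psd.

(** * Null sets of symmetric matrices *)

Section Null.
Variables (R : realType) (n : nat).
Hypothesis n_gt0 : (0 < n)%N.
Local Notation box := (symmx R n * symmx R n)%type.
Implicit Types (E : set (symmx R n)) (s : seq box).

Definition box_proper (B : box) : Prop := forall i j, B.1 i j <= B.2 i j.

Definition box_volume (B : box) : R := sym_box_volume B.1 B.2.

(** Jordan content zero.  Finite covers, in contrast to countable ones, can be
    concatenated, which makes a countable union of such sets easy to cover. *)
Definition jordan_null E : Prop := forall e : R, 0 < e -> exists s,
  [/\ forall B, B \in s -> box_proper B,
      forall X, E X -> exists2 B, B \in s & sym_box B.1 B.2 X &
      \sum_(B <- s) box_volume B <= e].

Lemma box_volume_ge0 B : box_proper B -> 0 <= box_volume B.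
Proof. by move=> pB; do 2?apply: prodr_ge0 => ? _; rewrite subr_ge0. Qed.

Lemma box_volume0 : box_volume (0, 0) = 0.
Proof.
rewrite /box_volume /sym_box_volume (bigD1 (Ordinal n_gt0))//=.
by rewrite (bigD1 (Ordinal n_gt0))//= subrr !mul0r.
Qed.

Lemma box_proper0 : box_proper (0, 0).
Proof. by []. Qed.

Lemma sum_geometric_le (e : R) M : 0 < e ->
  \sum_(u <- iota 0 M) e / 2 ^+ u.+1 <= e.
Proof.
move=> e0; suff -> : \sum_(u <- iota 0 M) e / 2 ^+ u.+1 = e - e / 2 ^+ M.
  by rewrite gerBl divr_ge0 ?ltW// exprn_ge0.
elim: M => [|M IH]; first by rewrite big_nil expr0 divr1 subrr.
rewrite -[in LHS]addn1 iotaD big_cat /= big_seq1 IH add0n exprS.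
have : (2 : R) ^+ M != 0 by rewrite expf_neq0.
by move=> ?; field.
Qed.

(** The [u]-th set is covered up to [e / 2 ^ (u + 1)], as in any proof of
    countable subadditivity.  The boxes of all the finite covers are listed one
    cover after the other; an empty box in front of each cover makes the [T]
    first covers contain at least the [T] first boxes of the list. *)
Lemma outer_lebesgue_bigcup0 (I : countType) (F : I -> set (symmx R n)) E :
  (forall i, jordan_null (F i)) -> E `<=` \bigcup_i F i ->
  sym_outer_lebesgue E = 0%E.
Proof.
move=> F0 EF; apply/eqP; rewrite eq_le; apply/andP; split; last first.
  apply: le_ereal_inf_tmp => _ [B [pB _] <-].
  by apply: nneseries_ge0 => k _ _; rewrite lee_fin box_volume_ge0// => i j; exact: pB.
apply/lee_addgt0Pr => e e0; rewrite add0e.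
have /choice[s sP] : forall u, exists s,
    [/\ forall B, B \in s -> box_proper B,
        forall i X, unpickle u = Some i -> F i X ->
          exists2 B, B \in s & sym_box B.1 B.2 X,
        \sum_(B <- s) box_volume B <= e / 2 ^+ u.+1 &
        (0 < size s)%N].
  move=> u; have eu0 : 0 < e / 2 ^+ u.+1 by rewrite divr_gt0// exprn_gt0.
  case: (unpickle u) => [i|]; last first.
    exists [:: (0, 0)]; split => //; first by move=> B; rewrite inE => /eqP ->.
    by rewrite big_seq1 box_volume0 ltW.
  have [s [ps cs vs]] := F0 i _ eu0; exists ((0, 0) :: s); split => //.
  - by move=> B; rewrite inE => /predU1P[->//|]; exact: ps.
  - move=> j X [<-] /cs[B Bs XB]; exists B => //; by rewrite inE Bs orbT.
  - by rewrite big_cons box_volume0 add0r.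
pose S T := flatten [seq s u | u <- iota 0 T].
have S_proper T B : B \in S T -> box_proper B.
  by case/flattenP => _ /mapP[u _ ->]; case: (sP u) => + _ _ _; exact.
have S_cat T k : S (T + k)%N = S T ++ flatten [seq s u | u <- iota T k].
  by rewrite /S iotaD map_cat flatten_cat add0n.
have S_size T : (T <= size (S T))%N.
  elim: T => // T IH; rewrite -addn1 S_cat size_cat /= cats0 leq_add//.
  by case: (sP T).
pose B t := nth (0, 0) (S t.+1) t.
have B_nth T t : (t < T)%N -> B t = nth (0, 0) (S T) t.
  by move=> tT; rewrite -(subnK tT) addnC S_cat nth_cat S_size.
have B_in T t : (t < size (S T))%N -> B t = nth (0, 0) (S T) t.
  move=> tT; rewrite (@B_nth (T + t.+1)) ?S_cat ?nth_cat ?tT//.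
  by rewrite leq_addl.
have B_proper t : box_proper (B t) by apply/(S_proper t.+1)/mem_nth/S_size.
apply: ge_ereal_inf; exists (\sum_(0 <= k <oo) (box_volume (B k))%:E)%E.
  exists B => //; split=> [k i j|X /EF[i _ FX]]; first exact: B_proper.
  case: (sP (pickle i)) => _ /(_ i X (pickleK i) FX)[C Cs XC] _ _.
  have CS : C \in S (pickle i).+1.
    by rewrite -addn1 S_cat mem_cat /= cats0 Cs orbT.
  exists (index C (S (pickle i).+1)) => //.
  by rewrite (@B_in (pickle i).+1) ?index_mem// nth_index.
apply: lime_le.
  by apply: is_cvg_nneseries => k _ _; rewrite lee_fin box_volume_ge0.
apply: nearW => M; rewrite sumEFin lee_fin.
have /le_trans -> // : \sum_(0 <= k < M) box_volume (B k) <=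
    \sum_(C <- S M) box_volume C.
  rewrite [leRHS](big_nth (0, 0)) [leRHS](@big_cat_nat _ _ _ M)//= ?S_size//.
  rewrite big_nat_cond [X in _ <= X + _]big_nat_cond.
  under eq_bigr => k /andP[/andP[_ kM] _] do rewrite (B_nth M k kM).
  rewrite lerDl big_nat_cond sumr_ge0// => k /andP[/andP[_ kM] _].
  by rewrite box_volume_ge0//; apply/(S_proper M)/mem_nth.
rewrite big_flatten big_map /=; apply: le_trans (sum_geometric_le M e0).
by apply: ler_sum => u _; case: (sP u).
Qed.

Lemma truncn_close (x y : R) : 0 <= x -> 0 <= y ->
  Num.truncn x = Num.truncn y -> `|x - y| <= 1.
Proof.
move=> /truncn_itv/andP[x1 x2] /truncn_itv/andP[y1 y2] xy.
move: x1 x2; rewrite xy -natr1 => x1 x2; rewrite -natr1 in y2.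
by rewrite ler_norml; apply/andP; split; lra.
Qed.

Definition upper_pairs : {pred 'I_n * 'I_n} := fun x => (x.1 <= x.2)%N.

Lemma cube_subproof (C : symmx R n) (d : R) :
  symval C + const_mx d \in @is_symmx R n.
Proof. by rewrite unfold_in linearD /= symmx_tr trmx_const. Qed.

Definition cube C d : box := (Symmx (cube_subproof C (- d)), Symmx (cube_subproof C d)).

Lemma cube_volume C d : box_volume (cube C d) = (d *+ 2) ^+ #|upper_pairs|.
Proof.
rewrite /box_volume /sym_box_volume pair_big_dep /= -prodr_const.
by apply: eq_bigr => x _; rewrite !mxE opprD opprK addrACA subrr add0r mulr2n.
Qed.

Lemma cube_proper C d : 0 <= d -> box_proper (cube C d).
Proof. by move=> d0 i j; rewrite !mxE lerD2l ge0_cp. Qed.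

(** A Lipschitz image of a bounded subset of a coordinate hyperplane is null:
    [O(s ^ (N - 1))] cells of side [1 / s] cover the subset, and the image of
    each lies in a cube of volume [O(s ^ - N)], where [N = n (n + 1) / 2].  The
    Lipschitz function is given by its graph [G], whose first component is the
    value and second component the argument. *)
Lemma lipschitz_hyperplane_null (i j : 'I_n) (q K L : R) E
    (G : symmx R n -> symmx R n -> Prop) :
  (i <= j)%N -> 0 <= L ->
  (forall C, E C -> exists P, G C P) ->
  (forall C P, G C P -> P i j = q /\ forall a b, `|P a b| <= K) ->
  (forall C C' P P' d, G C P -> G C' P' ->
    (forall a b, `|P a b - P' a b| <= d) ->
    forall a b, `|C a b - C' a b| <= L * d) ->
  jordan_null E.
Proof.
move=> ij L0 EG Gb GL e e0.
have [k Kk] : exists k : nat, K <= k%:R.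
  by exists (Num.truncn K).+1; apply/ltW/truncnS_gt.
(* The free coordinates on the hyperplane. *)
pose T := {x : 'I_n * 'I_n | (x \in upper_pairs) && (x != (i, j))}.
have cT : #|upper_pairs| = #|{: T}|.+1.
  rewrite card_sig (cardD1 (i, j)) [_ \in _]ij add1n; congr _.+1.
  by apply: eq_card => x; rewrite !inE andbC.
pose c : R := (2 * k%:R + 1) ^+ #|{: T}| * (L *+ 2) ^+ #|upper_pairs|.
have c0 : 0 <= c by rewrite mulr_ge0// exprn_ge0 ?addr_ge0 ?mulr_ge0 ?mulrn_wge0.
have [s [s0 cs]] : exists s : nat, (0 < s)%N /\ c / s%:R <= e.
  exists (Num.truncn (c / e)).+1; split => //.
  by rewrite ler_pdivrMr// mulrC -ler_pdivrMr//; apply/ltW/truncnS_gt.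
have s0R : 0 < s%:R :> R by rewrite ltr0n.
pose cell (P : symmx R n) : {ffun T -> 'I_(2 * k * s).+1} :=
  [ffun x : T => inord (Num.truncn ((P (val x).1 (val x).2 + k%:R) * s%:R))].
have d0 : 0 <= L / s%:R by rewrite divr_ge0// ltW.
have cell_close C C' P P' : G C P -> G C' P' -> cell P = cell P' ->
    forall a b, `|C a b - C' a b| <= L / s%:R.
  move=> GC GC' cc; apply: (GL _ _ _ _ _ GC GC').
  suff H (a b : 'I_n) : (a <= b)%N -> `|P a b - P' a b| <= s%:R^-1.
    move=> a b; case: (leqP a b) => [/H//|/ltnW/H].
    by rewrite symmx_entryC [P' b a]symmx_entryC.
  move=> ab; have [[Pq PK] [Pq' PK']] := (Gb _ _ GC, Gb _ _ GC').
  have [[-> ->]|abij] := eqVneq (a, b) (i, j).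
    by rewrite Pq Pq' subrr normr0 invr_ge0 ltW.
  have xT : ((a, b) \in upper_pairs) && ((a, b) != (i, j)) by rewrite [_ \in _]ab.
  have pos (Q : symmx R n) : (forall a b, `|Q a b| <= K) ->
      0 <= (Q a b + k%:R) * s%:R <= (2 * k * s)%:R.
    move=> /(_ a b)/le_trans/(_ Kk); rewrite ler_norml => /andP[Q1 Q2].
    apply/andP; split; first by rewrite pmulr_lge0//; lra.
    by rewrite natrM ler_pM2r// natrM; lra.
  have tr (Q : symmx R n) : (forall a b, `|Q a b| <= K) ->
      (Num.truncn ((Q a b + k%:R) * s%:R)  < (2 * k * s).+1)%N.
    by move=> /pos/andP[p1 p2]; rewrite ltnS -(ler_nat R) (le_trans _ p2)// truncn_le.
  have := congr1 (fun f : {ffun T -> _} => val (f (Sub (a, b) xT))) cc.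
  rewrite !ffunE /= !inordK ?tr// => /truncn_close.
  move=> /(_ (proj1 (andP (pos P PK))) (proj1 (andP (pos P' PK')))).
  rewrite -mulrBl opprD addrACA subrr addr0 normrM [`|s%:R|]gtr0_norm//.
  by rewrite -ler_pdivlMr// div1r.
have /choice[B BP] : forall f : {ffun T -> 'I_(2 * k * s).+1}, exists B : box,
    [/\ box_proper B, box_volume B <= (L *+ 2 / s%:R) ^+ #|upper_pairs| &
     forall C P, G C P -> cell P = f -> sym_box B.1 B.2 C].
  (* A cell without any argument of the function gets an empty box. *)
  move=> f; have [[[C P] /= [GC Pf]]|no] :=
    pselect (exists CP : box, G CP.1 CP.2 /\ cell CP.2 = f).
    exists (cube C (L / s%:R)); split; first exact: cube_proper.
      by rewrite cube_volume mulrnAl.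
    move=> C' P' GC' Pf' a b; rewrite !mxE.
    have := cell_close _ _ _ _ GC' GC (etrans Pf' (esym Pf)) a b.
    by rewrite ler_norml => /andP[? ?]; apply/andP; split; lra.
  exists (0, 0); split; first exact: box_proper0.
    by rewrite box_volume0 exprn_ge0// divr_ge0 ?mulrn_wge0// ltW.
  by move=> C P GC Pf; case: no; exists (C, P).
exists [seq B f | f <- enum {ffun T -> 'I_(2 * k * s).+1}]; split.
- by move=> _ /mapP[f _ ->]; case: (BP f).
- move=> C /EG[P GC]; exists (B (cell P)); first by apply: map_f; rewrite mem_enum.
  by case: (BP (cell P)) => _ _ BP3; apply: (BP3 _ P).
rewrite big_map big_enum /=.
apply: (@le_trans _ _ (\sum_(f : {ffun T -> 'I_(2 * k * s).+1})
    (L *+ 2 / s%:R) ^+ #|upper_pairs|)).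
  by apply: ler_sum => f _; case: (BP f).
rewrite sumr_const card_ffun card_ord -[leLHS]mulr_natr (le_trans _ cs)//.
have -> : c / s%:R = (L *+ 2) ^+ #|upper_pairs| / s%:R * (2 * k%:R + 1) ^+ #|{: T}|.
  by rewrite /c -mulrA mulrC.
have -> : (L *+ 2 / s%:R) ^+ #|upper_pairs| * ((2 * k * s).+1 ^ #|{: T}|)%:R =
    (L *+ 2) ^+ #|upper_pairs| / s%:R * ((2 * k * s).+1%:R / s%:R) ^+ #|{: T}|.
  rewrite natrX !expr_div_n {2}cT (exprS s%:R).
  have sT : s%:R ^+ #|{: T}| != 0 :> R by rewrite expf_neq0// gt_eqF.
  by field; rewrite sT gt_eqF.
apply: ler_wpM2l; first by rewrite divr_ge0 ?exprn_ge0 ?mulrn_wge0// ltW.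
apply: lerXn2r; rewrite ?nnegrE ?divr_ge0 ?addr_ge0 ?mulr_ge0//.
rewrite ler_pdivrMr// mulrDl mul1r -natr1 !natrM lerD2l.
by rewrite ler1n.
Qed.

End Null.

(** * Costs with a segment of stationary points *)

Section Complementary.
Variables (R : realType) (n m : nat).
Variables (A : {linear symmx R n -> 'cV[R]_m}) (b : 'cV[R]_m).

(** The constant is [k ^ 2] for each of the [n ^ 4] terms of the expanded
    triple product. *)
Lemma frob_cubic_le k (S D Y : 'M[R]_n) :
  bounded_entries k S -> bounded_entries k Y ->
  `|frob S (D *m Y *m D)| <= k ^+ 2 * n%:R ^+ 4 * frob D D.
Proof.
move=> kS kY; rewrite frobE.
have -> : k ^+ 2 * n%:R ^+ 4 * frob D D =
    n%:R * (n%:R * (n%:R * (n%:R * (k * (k * frob D D))))) by ring.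
apply: normr_sum_le_const => i; apply: normr_sum_le_const => j.
rewrite !mxE mulr_sumr; apply: normr_sum_le_const => l.
rewrite !mxE mulr_suml mulr_sumr; apply: normr_sum_le_const => h.
have DD : `|D i h * D l j| <= frob D D.
  have := sqr_entry_le_frob D i h; have := sqr_entry_le_frob D l j.
  move: (D i h) (D l j) (frob D D) => x y f xf yf.
  rewrite ler_norml; apply/andP; split; nra.
have -> : S i j * (D i h * Y h l * D l j) = S i j * (Y h l * (D i h * D l j)) by ring.
by rewrite !normrM; do 2!apply: ler_pM => //; rewrite -normrM.
Qed.

(** [X] and [S] are complementary: [S X = 0].  When [S] is a dual slack of the
    cost [C], i.e. [C - S] is orthogonal to the kernel of [A], this is the
    stationarity condition of the semidefinite program, without the sign of
    [S].  The generalized inverse [Y] of [X] quantifies how far the nonzero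
    eigenvalues of [X] stay away from [0]. *)
Definition complementary k (C X : symmx R n) : Prop :=
  A X = b /\ exists (S : symmx R n) (Y : 'M[R]_n),
  [/\ forall Z, A Z = 0 -> frob (C - S) Z = 0,
      symval S *m X = 0, X *m Y *m X = symval X &
      bounded_entries k S /\ bounded_entries k Y].

(** As [S X' = X' S = 0], one has
    [<S, X> = <S, X Y X> = <S, (X - X') Y (X - X')>]: the pairing of a slack
    with another solution is of second order in the distance of the two
    solutions. *)
Lemma frob_complementary_le k (S X' X : symmx R n) (Y : 'M[R]_n) :
  symval S *m X' = 0 -> X *m Y *m X = symval X ->
  bounded_entries k S -> bounded_entries k Y ->
  `|frob S X| <=
  k ^+ 2 * n%:R ^+ 4 * frob (symval X - symval X') (symval X - symval X').
Proof.
move=> SX' XYX kS kY.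
have X'S : symval X' *m S = 0.
  by rewrite -[symval S]symmx_tr -[symval X']symmx_tr -trmx_mul SX' trmx0.
have SXl P : frob S (symval X' *m P) = 0.
  by rewrite frobC frob_mull symmx_tr X'S frob0r.
have SXr P : frob S (P *m symval X') = 0.
  by rewrite frobC frob_mulr symmx_tr SX' frob0r.
have -> : frob S X =
    frob S ((symval X - symval X') *m Y *m (symval X - symval X')).
  rewrite mulmxBr !mulmxBl XYX !frobBr !SXr.
  by rewrite -mulmxA SXl !subr0.
exact: frob_cubic_le.
Qed.

(** On complementary pairs [C] is a Lipschitz function of [t X - C] for a large
    constant [t].  Complementarity makes [<X - X', C - C'>] at most of the
    order of [|X - X'| ^ 2], so that [t X - C] determines [X], with a
    Lipschitz bound, and then [C]. *)
Lemma complementary_lipschitz k t (C C' X X' : symmx R n) :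
  2 * (k ^+ 2 * n%:R ^+ 4) + 1 <= t ->
  complementary k C X -> complementary k C' X' ->
  let D := symval X - symval X' in let c := symval C - symval C' in
  frob c c <= 2 * (t ^+ 2 + 1) * frob (t *: D - c) (t *: D - c).
Proof.
move=> tk [AX [S [Y [CS SX XYX [kS kY]]]]] [AX' [S' [Y' [CS' SX' XYX' [kS' kY']]]]] /=.
have A0 : A (X - X') = 0 by rewrite linearB /= AX AX' subrr.
have := frob_complementary_le SX XYX' kS kY'.
have := frob_complementary_le SX' XYX kS' kY.
have -> : frob (symval X' - symval X) (symval X' - symval X) =
    frob (symval X - symval X') (symval X - symval X').
  by rewrite -opprB frobNl frobNr opprK.
have S0 (S0 X0 : symmx R n) : symval S0 *m X0 = 0 -> frob S0 X0 = 0.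
  by move=> h; rewrite /frob symmx_tr h mxtrace0.
have DC : frob (symval C - symval C') (symval X - symval X') = - frob S X' - frob S' X.
  have /eqP := CS _ A0; have /eqP := CS' _ A0.
  rewrite !symmx_subE !frobBl !subr_eq0 => /eqP -> /eqP ->.
  by rewrite !frobBr (S0 _ _ SX) (S0 _ _ SX') sub0r subr0.
move: (frob S' X) (frob S X') DC => s' s.
move: (symval X - symval X') (symval C - symval C') => D c DC.
move: (k ^+ 2 * _) tk => K tk; rewrite !ler_norml => /andP[s'1 s'2] /andP[s1 s2].
(* [|D| ^ 2 <= <D, w> <= (|D| ^ 2 + |w| ^ 2) / 2] and [c = t D - w]. *)
pose w := t *: D - c; rewrite -/w.
have cE : c = t *: D - w by rewrite /w opprB addrC subrK.
have Dw : frob D w = t * frob D D + s + s'.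
  by rewrite /w frobBr frobZr (frobC D) DC; ring.
clearbody w.
have := frob_ge0 (D - w); have := frob_ge0 (t *: D + w).
have -> : frob c c = t ^+ 2 * frob D D - 2 * t * frob D w + frob w w.
  by rewrite cE !(frobBl, frobBr, frobZl, frobZr) (frobC w D); ring.
rewrite !(frobBl, frobBr, frobDl, frobDr, frobZl, frobZr, frobNl, frobNr) (frobC w D).
have := frob_ge0 D; have := frob_ge0 w.
move: (frob D D) (frob D w) (frob w w) Dw s1 s2 s'1 s'2 => d e f -> *.
have df : d <= f.
  have td : 0 <= (t - 2 * K - 1) * d by rewrite mulr_ge0//; lra.
  by lra.
have tdf : t ^+ 2 * d <= t ^+ 2 * f by rewrite ler_wpM2l// sqr_ge0.
by lra.
Qed.

(** The constant [t] of [complementary_lipschitz]. *)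
Definition shift_const (k : R) : R := 2 * (k ^+ 2 * n%:R ^+ 4) + 1.

Lemma shift_const_ge1 k : 1 <= shift_const k.
Proof. by rewrite lerDr mulr_ge0// mulr_ge0 ?sqr_ge0// exprn_ge0. Qed.

Lemma complementary_slice_null k l (i j : 'I_n) q : (0 < n)%N -> (i <= j)%N ->
  jordan_null [set C : symmx R n | exists X : symmx R n,
    let P := shift_const k *: X - C in
    [/\ complementary k C X, bounded_entries l P & P i j = q]].
Proof.
move=> n_gt0 ij; pose t := shift_const k.
pose G (C P : symmx R n) := exists X : symmx R n,
  [/\ complementary k C X, P = t *: X - C, bounded_entries l P & P i j = q].
pose M : R := 2 * (t ^+ 2 + 1) * n%:R ^+ 2.
have M0 : 0 <= M by rewrite mulr_ge0 ?exprn_ge0// mulr_ge0// addr_ge0// sqr_ge0.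
apply: (@lipschitz_hyperplane_null _ _ n_gt0 i j q l (Num.sqrt M) _ G) => //.
- by move=> C [X [CX bP Pq]]; exists (t *: X - C), X.
- by move=> C P [X [_ _ bP Pq]].
move=> C C' P P' d [X [CX PE _ _]] [X' [CX' PE' _ _]] Pd a c.
have d0 : 0 <= d by apply: le_trans (Pd a a).
have := complementary_lipschitz (lexx t) CX CX' => /=.
have -> : t *: (symval X - symval X') - (symval C - symval C') = symval P - symval P'.
  by rewrite PE PE' !symmx_subE !symmx_scaleE scalerBr !opprB addrACA [RHS]addrACA;
     congr (_ + _); rewrite addrC.
move=> CM; have -> : Num.sqrt M * d = Num.sqrt (M * d ^+ 2).
  by rewrite [RHS]sqrtrM// sqrtr_sqr ger0_norm.
rewrite -sqrtr_sqr ler_sqrt ?(mulr_ge0 M0 (sqr_ge0 d))//.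
have := sqr_entry_le_frob (symval C - symval C') a c.
rewrite !mxE => /le_trans; apply; apply: le_trans CM _.
rewrite /M -[leRHS]mulrA ler_wpM2l//; first by rewrite mulr_ge0// addr_ge0 ?sqr_ge0.
rewrite expr2 -mulrA; apply: frob_entries_le => u v.
by rewrite !mxE.
Qed.

(** Costs for which the solutions are not isolated.  A segment of solutions
    [X] of the same cost is mapped by [X |-> t X - C] onto a segment, on which
    a suitable coordinate takes a rational value: these costs are covered by
    countably many Lipschitz images of pieces of hyperplanes. *)
Lemma complementary_segment_null (E : set (symmx R n)) : (0 < n)%N ->
  (forall C, E C -> exists k e (X H : symmx R n),
    [/\ 0 < e, H != 0 & forall s, `|s| <= e -> complementary k C (X + s *: H)]) ->
  sym_outer_lebesgue E = 0%E.
Proof.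
move=> n_gt0 EH.
pose I := (nat * nat * {x : 'I_n * 'I_n | x \in @upper_pairs n} * rat)%type.
pose F (u : I) : set (symmx R n) := let: (k, l, x, q) := u in
  [set C | exists X : symmx R n, let P := shift_const k%:R *: X - C in
    [/\ complementary k%:R C X, bounded_entries l%:R P &
        P (val x).1 (val x).2 = ratr q]].
apply: (@outer_lebesgue_bigcup0 _ _ n_gt0 I F).
  by case=> [[[k l] [x xx]] q]; apply: complementary_slice_null.
move=> C /EH[k0 [e [X [H [e0 H0 CX]]]]].
have [k kk] : exists k : nat, k0 <= k%:R.
  by exists (Num.truncn k0).+1; apply/ltW/truncnS_gt.
have {CX k0 kk} CX s : `|s| <= e -> complementary k%:R C (X + s *: H).
  move=> /CX[AX [S [Y [? ? ? [kS kY]]]]]; split=> //; exists S, Y; split=> //.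
  by split=> a c; [exact: le_trans (kS a c) kk | exact: le_trans (kY a c) kk].
have [x [xx Hx]] : exists x, x \in @upper_pairs n /\ H x.1 x.2 != 0.
  apply: contrapT => no; case/eqP: H0; apply/val_inj/matrixP => a c.
  rewrite [RHS]mxE; apply/eqP; apply: contraT => Hac; case: no.
  case: (leqP a c) => [ac|/ltnW ca]; first by exists (a, c).
  by exists (c, a); split=> //; rewrite symmx_entryC.
pose t := shift_const k%:R; pose h := t * H x.1 x.2.
pose y := t * X x.1 x.2 - C x.1 x.2.
have t0 : 0 < t by apply: lt_le_trans (shift_const_ge1 _).
have h0 : h != 0 by rewrite mulf_neq0// gt_eqF.
have [q qy] : exists q : rat, ratr q \in `]y - `|h| * e, y + `|h| * e[.
  have he : 0 < `|h| * e by rewrite mulr_gt0// normr_gt0.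
  by have [|q] := @rat_in_itvoo R (y - `|h| * e) (y + `|h| * e); [lra|exists q].
pose s := (ratr q - y) / h.
have se : `|s| <= e.
  rewrite normrM normfV ler_pdivrMr ?normr_gt0// mulrC ler_norml.
  by move: qy; rewrite in_itv/= => /andP[q1 q2]; apply/andP; split; lra.
pose P : symmx R n := t *: (X + s *: H) - C.
have [l Pl] : exists l : nat, bounded_entries l%:R P.
  exists (Num.truncn (frob P P + 1)).+1 => a c.
  by apply: le_trans (entries_bounded_by_frob P a c) _; exact/ltW/truncnS_gt.
exists ((k, l, Sub x xx), q) => //; exists (X + s *: H); split=> //.
  exact: CX.
have -> : P x.1 x.2 = y + s * h by rewrite !mxE /y /h; ring.
by rewrite divfK// addrC subrK.
Qed.

End Complementary.

(** * Second-order critical points *)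

Section Critical.
Variables (R : realType) (n m p : nat) (A : {linear symmx R n -> 'cV[R]_m}).
Implicit Types (V U G D : 'M[R]_(n, p)) (C S : symmx R n) (y : 'cV[R]_m).
Local Notation T := (@bm_tangent R n m A p).

Definition row_adj i : symmx R n := adj A (delta_mx i 0).

Lemma tangentZ V a U : T V U -> T V (a *: U).
Proof. by move=> h; rewrite /bm_tangent /= dgramZ linearZ /= h scaler0. Qed.

Lemma tangentB V U G : T V U -> T V G -> T V (U - G).
Proof.
move=> hU hG; rewrite /bm_tangent /= -scaleN1r dgramD dgramZ linearD linearZ /=.
by rewrite hU hG scaler0 addr0.
Qed.

(** The [adj A y *m V] are the normal vectors to the feasible set at [V]. *)
Lemma normal_orth_tangent V y U : T V U -> frob (symval (adj A y) *m V) U = 0.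
Proof.
move=> TU; apply: (@mulfI _ 2); first by rewrite pnatr_eq0.
by rewrite -frob_dgram frob_adj TU mulmx0 mxE mulr0.
Qed.

Definition normal_gram V : 'M[R]_m :=
  \matrix_(i, j) frob (symval (row_adj i) *m V) (symval (row_adj j) *m V).

Lemma adj_mulE y V : symval (adj A y) *m V = \sum_i y i 0 *: (symval (row_adj i) *m V).
Proof.
by rewrite adj_sum mulmx_suml; apply: eq_bigr => i _; rewrite scalemxAl.
Qed.

Lemma normal_gram_mul V y i :
  (normal_gram V *m y) i 0 = frob (symval (row_adj i) *m V) (symval (adj A y) *m V).
Proof.
rewrite adj_mulE frob_sumr mxE; apply: eq_bigr => j _.
by rewrite mxE frobZr mulrC.
Qed.

Lemma normal_gram_unit V :
  (forall y, exists U, A (dgram V U) = y) -> normal_gram V \in unitmx.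
Proof.
move=> surj; rewrite unitmxE unitfE; apply/det0P => -[v v0 vN].
have tN : (normal_gram V)^T = normal_gram V.
  by apply/matrixP => i j; rewrite !mxE frobC.
have Nv : normal_gram V *m v^T = 0 by rewrite -tN -trmx_mul vN trmx0.
suff : v^T = 0 by move/(congr1 trmx)/eqP; rewrite trmxK trmx0 (negPf v0).
apply: (adj_mul_eq0 surj); apply: frob_eq0.
rewrite {1}adj_mulE frobC frob_sumr big1// => i _.
by rewrite frobZr frobC -normal_gram_mul Nv [X in _ * X]mxE mulr0.
Qed.

(** The orthogonal projection to the tangent space subtracts the normal
    component of [D], whose coordinates [y] solve the normal equations. *)
Lemma tangent_residual V D y :
  normal_gram V *m y = \col_i frob (symval (row_adj i) *m V) D ->
  T V (D - symval (adj A y) *m V).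
Proof.
move=> Ny; apply/colP => i; rewrite -frob_adj_delta frob_dgram [RHS]mxE.
by rewrite frobBr -normal_gram_mul Ny mxE subrr mulr0.
Qed.

Lemma tangent_residual_exists V D : normal_gram V \in unitmx ->
  exists y, T V (D - symval (adj A y) *m V).
Proof.
move=> uN; exists (invmx (normal_gram V) *m \col_i frob (symval (row_adj i) *m V) D).
by apply: tangent_residual; rewrite mulKVmx.
Qed.

Lemma frob_orth_proj V U D : normal_gram V \in unitmx -> T V U ->
  frob U (orth_proj (T V) D) = frob U D.
Proof.
move=> uN TU; have [y Ty] := tangent_residual_exists D uN.
have : exists Y, T V Y /\ forall W, T V W -> frob (D - Y) W = 0.
  exists (D - symval (adj A y) *m V); split => // W TW.
  by rewrite opprB addrC subrK normal_orth_tangent.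
move=> /(xgetPex 0) [_ /(_ U TU)].
by rewrite frobBl => /eqP; rewrite subr_eq0 !(frobC _ U) => /eqP ->.
Qed.

(** All the directional derivatives below are computed from an explicit
    difference quotient [g], continuous at [0]. *)
Lemma derive_quotient (W : normedModType R) (f : 'M[R]_(n, p) -> W) V U (g : R -> W) :
  (\forall h \near 0, f (h *: U + V) - f V = h *: g h) ->
  {for 0, continuous g} -> 'D_U f V = g 0.
Proof.
move=> fg gc; apply: cvg_lim => //.
move/continuous_withinNx : gc; apply: cvg_trans.
apply: near_eq_cvg; near=> h.
have h0 : h != 0 by near: h; exact: nbhs_dnbhs_neq.
have -> : (f \o shift V) (h *: U) - f V = h *: g h.
  by rewrite /=; near: h; exact: nbhs_dnbhs.
by rewrite scalerA mulVf ?scale1r.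
Unshelve. all: by end_near. Qed.

Lemma derive_bm_cost C V U :
  'D_U (bm_cost C : 'M[R]_(n, p) -> R) V = 2 * frob (symval C *m V) U.
Proof.
pose g h := 2 * frob (symval C *m V) U + h * frob C (gram U).
rewrite (@derive_quotient _ _ _ _ g); first by rewrite /g mul0r addr0.
  near=> h; rewrite /g /bm_cost /=.
  rewrite linearD linearZ /= mulmxDl !mulmxDr -!scalemxAl -!scalemxAr.
  rewrite !(frobDr, frobZr) !frob_symmx_gram.
  rewrite [frob (_ *m U) V]frob_symmx_mul [frob U _]frobC -[h *: _]/(h * _).
  by ring.
rewrite /g; apply: cvgD; first exact: cvg_cst.
exact: cvgM cvg_id (cvg_cst _).
Unshelve. all: by end_near. Qed.

Lemma rgradE C V y : T V (symval (C - adj A y) *m V) ->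
  rgrad T (bm_cost C) V = 2 *: (symval (C - adj A y) *m V).
Proof.
move=> TG; have G U : T V U ->
    frob (2 *: (symval (C - adj A y) *m V)) U = 'D_U (bm_cost C : 'M[R]_(n, p) -> R) V.
  move=> TU; rewrite derive_bm_cost frobZl symmx_subE mulmxBl frobBl.
  by rewrite normal_orth_tangent// subr0.
apply: xget_unique; first by split=> //; exact: tangentZ.
move=> H [TH HG]; apply/eqP; rewrite -subr_eq0; apply/eqP/frob_eq0.
have TB := tangentB TH (tangentZ 2 TG).
by rewrite {1}frobBl HG// G// subrr.
Qed.

Lemma adj_mulD_scale y z h V : symval (adj A (y + h *: z)) *m V =
  symval (adj A y) *m V + h *: (symval (adj A z) *m V).
Proof.
rewrite !adj_mulE scaler_sumr -big_split /=; apply: eq_bigr => i _.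
by rewrite !mxE scalerDl scalerA.
Qed.

(** Along the line [V + h U], the normal Gram matrix and the products of the
    normals with a fixed [D] are polynomials in [h]; the multipliers are then
    rational functions of [h], by Cramer's rule. *)
Definition gram_poly V U : 'M[{poly R}]_m := \matrix_(i, j)
  ((frob (symval (row_adj i) *m V) (symval (row_adj j) *m V))%:P +
   (frob (symval (row_adj i) *m U) (symval (row_adj j) *m V) +
    frob (symval (row_adj i) *m V) (symval (row_adj j) *m U))%:P * 'X +
   (frob (symval (row_adj i) *m U) (symval (row_adj j) *m U))%:P * 'X^2).

Definition normal_poly V U D : 'cV[{poly R}]_m := \col_i
  ((frob (symval (row_adj i) *m V) D)%:P + (frob (symval (row_adj i) *m U) D)%:P * 'X).

Definition cramer V U D (h : R) : 'cV[R]_m := \col_i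
  (((\adj (gram_poly V U) *m normal_poly V U D) i 0).[h] / (\det (gram_poly V U)).[h]).

Lemma gram_polyE V U h :
  map_mx (horner_eval h) (gram_poly V U) = normal_gram (h *: U + V).
Proof.
apply/matrixP => i j; rewrite !mxE /horner_eval.
rewrite !(hornerD, hornerM, hornerC, hornerX, hornerXn) !mulmxDr -!scalemxAr.
by rewrite !(frobDl, frobDr, frobZl, frobZr); ring.
Qed.

Lemma normal_polyE V U D h i :
  (normal_poly V U D i 0).[h] = frob (symval (row_adj i) *m (h *: U + V)) D.
Proof.
rewrite mxE !(hornerD, hornerM, hornerC, hornerX) mulmxDr -scalemxAr frobDl frobZl.
by ring.
Qed.

Lemma cramerP V U D h : (\det (gram_poly V U)).[h] != 0 ->
  normal_gram (h *: U + V) *m cramer V U D h =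
  \col_i frob (symval (row_adj i) *m (h *: U + V)) D.
Proof.
move=> d0; pose X := \adj (gram_poly V U) *m normal_poly V U D.
have -> : cramer V U D h =
    (\det (gram_poly V U)).[h]^-1 *: map_mx (horner_eval h) X.
  by apply/colP => i; rewrite [LHS]mxE [RHS]mxE [in RHS]mxE mulrC.
rewrite -scalemxAr -gram_polyE -map_mxM /X mulmxA mul_mx_adj mul_scalar_mx.
apply/colP => i; rewrite [LHS]mxE [X in _ * X]mxE [(_ *: normal_poly _ _ _) _ _]mxE.
by rewrite /= /horner_eval hornerM normal_polyE mulKf// [RHS]mxE.
Qed.

Lemma continuous_cramer V U D i : (\det (gram_poly V U)).[0] != 0 ->
  {for 0, continuous (fun h => cramer V U D h i 0)}.
Proof.
move=> d0; have -> : (fun h => cramer V U D h i 0) = fun h =>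
    ((\adj (gram_poly V U) *m normal_poly V U D) i 0).[h] / (\det (gram_poly V U)).[h].
  by apply/funext => h; rewrite mxE.
by apply: cvgM; [|apply: cvgV => //]; exact: continuous_horner.
Qed.

(** With [S V = 0], the gradient at [V + h U] is [h] times
    [2 (S U - adj (mu h) (V + h U))], where [mu h] solves the normal equations
    at [V + h U] for [S U], and is continuous at [0].  The derivative of the
    gradient at [V] is thus [2 S U] up to a normal vector. *)
Lemma second_order_critical_slack b C V : p_regular A b p ->
  second_order_critical A b C V ->
  exists y, let S : symmx R n := C - adj A y in
    symval S *m V = 0 /\ forall U, T V U -> 0 <= frob U (symval S *m U).
Proof.
move=> reg [fV gV hV]; have uN := normal_gram_unit (reg V fV).
have [y Ty] := tangent_residual_exists (symval C *m V) uN.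
have SV : symval (C - adj A y) *m V = 0.
  rewrite symmx_subE mulmxBl; apply/eqP.
  have := rgradE (C := C) (V := V) (y := y); rewrite symmx_subE mulmxBl => /(_ Ty).
  by rewrite gV => /esym/eqP; rewrite scaler_eq0 pnatr_eq0.
exists y; split => // U TU; have := hV U TU.
rewrite /rhess frob_orth_proj//.
pose S : symmx R n := C - adj A y.
pose mu h := cramer V U (symval S *m U) h.
have d0 : (\det (gram_poly V U)).[0] != 0.
  rewrite -[_.[0]]/(horner_eval 0 _) -det_map_mx gram_polyE scale0r add0r.
  by rewrite -unitfE -unitmxE.
pose g h := 2 *: (symval S *m U -
  \sum_i mu h i 0 *: (symval (row_adj i) *m (h *: U + V))).
have -> : 'D_U (rgrad T (bm_cost C)) V = g 0.
  apply: derive_quotient; last first.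
    apply: cvgZr; apply: cvgB; first exact: cvg_cst.
    apply: cvg_big => [|i _]; first exact: add_continuous.
    apply: cvgZ; first exact: continuous_cramer.
    under [X in X @ _]eq_fun do rewrite mulmxDr -scalemxAr.
    rewrite mulmxDr -scalemxAr; apply: cvgD; last exact: cvg_cst.
    exact: cvgZr_tmp.
  near=> h; rewrite gV subr0.
  have dh : (\det (gram_poly V U)).[h] != 0.
    by near: h; apply: cvgr_neq0 d0; exact: continuous_horner.
  have SW : symval S *m (h *: U + V) = h *: (symval S *m U).
    by rewrite mulmxDr SV addr0 scalemxAr.
  rewrite (@rgradE _ _ (y + h *: mu h)).
    rewrite symmx_subE mulmxBl adj_mulD_scale opprD addrA -mulmxBl -symmx_subE.
    by rewrite SW -scalerBr adj_mulE scalerA mulrC -scalerA.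
  rewrite symmx_subE mulmxBl; apply: tangent_residual.
  apply/colP => i; rewrite normal_gram_mul adj_mulD_scale frobDr frobZr.
  rewrite -[X in _ + _ * X]normal_gram_mul cramerP// mxE [RHS]mxE -frobZr -SW -frobDr.
  by rewrite symmx_subE mulmxBl [_ + (_ - _)]addrC subrK.
rewrite /g scale0r add0r -adj_mulE frobZr frobBr [frob U (_ *m V)]frobC.
by rewrite normal_orth_tangent// subr0 pmulr_rge0.
Unshelve. all: by end_near. Qed.

End Critical.

(** * Stationary segments at an indefinite slack *)

Section Directions.
Variable R : realType.

Lemma card_lower_pairs p :
  #|[set x : 'I_p * 'I_p | (x.2 <= x.1)%N]%SET| = ((p * p.+1) %/ 2)%N.
Proof.
transitivity (\sum_(i < p) \sum_(j < p | (j <= i)%N) 1)%N.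
  by rewrite -sum1dep_card pair_big_dep.
transitivity (\sum_(i < p) i.+1)%N.
  apply: eq_bigr => i _; rewrite -[RHS]card_ord -sum1_card.
  by rewrite [RHS](big_ord_widen p (fun=> 1%N)).
have -> : (\sum_(i < p) i.+1 = \sum_(0 <= i < p.+1) i)%N.
  by rewrite big_nat_recl// add0n big_mkord.
by rewrite bin2_sum bin2 /= mulnC divn2.
Qed.

(** More unknowns than equations: [p] coordinates of [w] and [p (p + 1) / 2]
    coordinates of a lower triangular [M]. *)
Lemma triangular_kernel m p (f : 'I_p -> 'cV[R]_m) (F : 'I_p -> 'I_p -> 'cV[R]_m) :
  (m < (p * p.+1) %/ 2 + p)%N ->
  exists (w : 'rV[R]_p) (M : 'M[R]_p),
  [/\ w != 0 \/ M != 0, forall i j : 'I_p, (i < j)%N -> M i j = 0 &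
      \sum_j w 0 j *: f j + \sum_i \sum_j M i j *: F i j = 0].
Proof.
pose S := [set x : 'I_p * 'I_p | (x.2 <= x.1)%N]%SET.
rewrite -card_lower_pairs -/S addnC => mp.
pose K : 'M[R]_(p + #|S|, m) := col_mx (\matrix_(j, k) f j k 0)
  (\matrix_(t, k) F (enum_val t).1 (enum_val t).2 k 0).
have : kermx K != 0.
  rewrite kermx_eq0 /row_free neq_ltn; apply/orP; left.
  exact: leq_ltn_trans (rank_leq_col _) mp.
case/rowV0Pn => v /sub_kermxP vK v0.
pose w := lsubmx v; pose u := rsubmx v.
have vE : v = row_mx w u by rewrite hsubmxK.
pose M : 'M[R]_p := \sum_(t < #|S|) u 0 t *: delta_mx (enum_val t).1 (enum_val t).2.
have ME t : M (enum_val t).1 (enum_val t).2 = u 0 t.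
  rewrite summxE (bigD1 t)//= !mxE !eqxx mulr1 big1 ?addr0// => t' tt'.
  rewrite !mxE; case: andP => [[/eqP e1 /eqP e2]|_]; last by rewrite mulr0.
  case/eqP: tt'; apply: enum_val_inj.
  by case: (enum_val t') (enum_val t) e1 e2 => [? ?] [? ?] /= -> ->.
have Mlow (i j : 'I_p) : (i < j)%N -> M i j = 0.
  move=> ij; rewrite summxE big1// => t _; rewrite !mxE.
  case: andP => [[/eqP e1 /eqP e2]|_]; last by rewrite mulr0.
  by have := enum_valP t; rewrite inE -e1 -e2 leqNgt ij.
exists w, M; split => //.
  apply/orP; apply: contraNT v0; rewrite negb_or !negbK => /andP[/eqP w0 /eqP M0].
  rewrite vE w0; apply/eqP; rewrite -[RHS]row_mx0; congr row_mx.
  by apply/rowP => t; rewrite -ME M0 !mxE.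
apply/colP => k; have := congr1 (fun N : 'rV_m => N 0 k) vK.
rewrite vE mul_row_col mxE [in RHS]mxE => vK0.
rewrite mxE [RHS]mxE -[RHS]vK0 !summxE; congr (_ + _).
  by rewrite [RHS]mxE; apply: eq_bigr => j _; rewrite !mxE.
rewrite [RHS]mxE.
under eq_bigr do rewrite summxE.
rewrite pair_big /= (bigID (mem S)) /= [X in _ + X]big1 ?addr0; last first.
  by move=> [i j] /=; rewrite inE -ltnNge => /Mlow ij; rewrite mxE ij mul0r.
by rewrite big_enum_val /=; apply: eq_bigr => t _; rewrite mxE ME !mxE.
Qed.

Lemma left_inverse n p (V : 'M[R]_(n, p)) :
  (forall w : 'rV[R]_p, w *m V^T = 0 -> w = 0) ->
  exists L : 'M[R]_(p, n), L *m V = 1%:M.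
Proof.
move=> Vinj; have : row_free V^T.
  rewrite -kermx_eq0; apply/negPn/rowV0Pn => -[w /sub_kermxP/Vinj ->].
  by rewrite eqxx.
by case/row_freeP => B VB; exists B^T; rewrite -[V]trmxK -trmx_mul VB trmx1.
Qed.

(** For [|s| |N| <= 1 / 2] the form [x^T (1 + s N) x] is at least
    [|x| ^ 2 / 2]; a column [x] of the inverse then satisfies
    [|x| ^ 2 <= 2 x_j], whence [|x| <= 2]. *)
Lemma perturb_identity_inv p (N : 'M[R]_p) : N^T = N ->
  exists2 e : R, 0 < e & forall s, `|s| <= e ->
    1%:M + s *: N \in unitmx /\ bounded_entries 2 (invmx (1%:M + s *: N)).
Proof.
move=> sN; pose nu := frob N N + 1.
have Nnu := entries_bounded_by_frob N.
pose c := p%:R * (p%:R * nu).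
have nu0 : 0 <= nu by rewrite addr_ge0// frob_ge0.
have c0 : 0 <= c by rewrite mulr_ge0// mulr_ge0.
have xNx (x : 'cV[R]_p) : `|frob x (N *m x)| <= c * frob x x.
  have -> : c * frob x x = p%:R * (1%:R * (p%:R * (nu * frob x x))).
    by rewrite /c; ring.
  rewrite frobE; apply: normr_sum_le_const => i; apply: normr_sum_le_const => j.
  rewrite mxE mulr_sumr; apply: normr_sum_le_const => k; rewrite ord1.
  have -> : x i 0 * (N i k * x k 0) = N i k * (x i 0 * x k 0) by ring.
  rewrite normrM ler_pM//.
  have := sqr_entry_le_frob x i 0; have := sqr_entry_le_frob x k 0.
  move: (x i 0) (x k 0) (frob x x) => u v f uf vf.
  by rewrite ler_norml; apply/andP; split; nra.
exists (2 * (c + 1))^-1 => [|s se]; first by rewrite invr_gt0 mulr_gt0// ltr_wpDl.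
have coercive (x : 'cV[R]_p) : frob x x <= 2 * frob x ((1%:M + s *: N) *m x).
  rewrite mulmxDl mul1mx -scalemxAl frobDr frobZr.
  have sc : `|s| * c <= 2^-1.
    have c1 : 0 < c + 1 by rewrite ltr_wpDl.
    apply: (@le_trans _ _ ((2 * (c + 1))^-1 * c)); first exact: ler_wpM2r.
    by rewrite invfM -mulrA ler_piMr// mulrC ler_pdivrMr// mul1r lerDl.
  have : `|s * frob x (N *m x)| <= 2^-1 * frob x x.
    rewrite normrM; apply: (@le_trans _ _ (`|s| * (c * frob x x))).
      by rewrite ler_wpM2l.
    by rewrite mulrA ler_wpM2r// frob_ge0.
  by rewrite ler_norml => /andP[? ?]; lra.
have sG : (1%:M + s *: N)^T = 1%:M + s *: N.
  by rewrite linearD linearZ /= trmx1 sN.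
have uG : 1%:M + s *: N \in unitmx.
  rewrite unitmxE unitfE; apply/det0P => -[v v0 vG].
  have := coercive v^T; rewrite -sG -trmx_mul vG trmx0 frob0r mulr0 => vv.
  have /eqP : v^T = 0 by apply: frob_eq0; apply/eqP; rewrite eq_le vv frob_ge0.
  by rewrite trmx_eq0 (negPf v0).
split=> // i j; pose x := invmx (1%:M + s *: N) *m delta_mx j (0 : 'I_1).
have -> : invmx (1%:M + s *: N) i j = x i 0 by rewrite /x -colE mxE.
have Gx : frob x ((1%:M + s *: N) *m x) = x j 0.
  by rewrite [in X in frob _ X]/x mulKVmx// frob_delta.
have := coercive x; rewrite Gx.
have := sqr_entry_le_frob x j 0; have := sqr_entry_le_frob x i 0.
rewrite -[x i 0 ^+ 2]real_normK ?num_real//; have := normr_ge0 (x i 0).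
move: `|_| (x j 0) (frob x x) => u v f u0 uf vf fv.
have f4 : f <= 4 by nra.
by nra.
Qed.

End Directions.

Section Segment.
Variables (R : realType) (n m p : nat) (A : {linear symmx R n -> 'cV[R]_m}).
Implicit Types (V : 'M[R]_(n, p)) (S C X : symmx R n).

Lemma slack_form V S (z : 'cV[R]_n) (w : 'rV[R]_p) (M : 'M[R]_p) :
  symval S *m V = 0 ->
  frob (V *m M + z *m w) (symval S *m (V *m M + z *m w)) =
  (z^T *m S *m z) 0 0 * frob w w.
Proof.
move=> SV; rewrite mulmxDr mulmxA SV mul0mx add0r -frob_symmx_mul.
rewrite mulmxDr mulmxA SV mul0mx add0r mulmxA frob_mulr.
rewrite -mulmxA [w *m w^T]mx11_scalar mul_mx_scalar frobZr mulrC.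
congr (_ * _); last by rewrite /frob mxtrace_mulC trace_mx11.
by rewrite frobC /frob trace_mx11 mulmxA.
Qed.

(** By [slack_form], if [z^T S z < 0], no tangent vector [V M + z w] has
    [w != 0].  The vectors [z w] with [V w^T = 0] are tangent, so that [V] has
    full column rank; then a nonzero tangent [V M], with [M] lower triangular,
    exists for dimension reasons, and [N = M + M^T] is not [0]. *)
Lemma indefinite_slack_direction V S (z : 'cV[R]_n) :
  (m < (p * p.+1) %/ 2 + p)%N ->
  symval S *m V = 0 ->
  (forall U, bm_tangent A V U -> 0 <= frob U (symval S *m U)) ->
  (z^T *m S *m z) 0 0 < 0 ->
  exists (L : 'M[R]_(p, n)) (N : 'M[R]_p),
    [/\ L *m V = 1%:M, N^T = N, N != 0 &
     forall H : symmx R n, symval H = V *m N *m V^T -> A H = 0].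
Proof.
move=> mp SV hess zSz.
have w0 M w : bm_tangent A V (V *m M + z *m w) -> w = 0.
  move=> /hess; rewrite slack_form// nmulr_rge0// => ww.
  by apply: frob_eq0; apply/eqP; rewrite eq_le ww frob_ge0.
have [L LV] : exists L : 'M[R]_(p, n), L *m V = 1%:M.
  apply: left_inverse => w wV; apply: (w0 0); rewrite mulmx0 add0r.
  rewrite /bm_tangent /=; suff -> : dgram V (z *m w) = 0 by rewrite linear0.
  apply: val_inj; rewrite /= trmx_mul mulmxA -[V]trmxK -trmx_mul trmxK wV trmx0 mul0mx.
  by rewrite add0r -mulmxA wV mulmx0.
have [w [M [wM Mlow wMA]]] := triangular_kernel
  (fun j => A (dgram V (z *m delta_mx 0 j)))
  (fun i j => A (dgram V (V *m delta_mx i j))) mp.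
have TVM : bm_tangent A V (V *m M + z *m w).
  rewrite /bm_tangent /= -[RHS]wMA dgramD linearD addrC; congr (_ + _).
    rewrite {1}(row_sum_delta w) mulmx_sumr dgram_sum linear_sum.
    by apply: eq_bigr => j _; rewrite -scalemxAr dgramZ linearZ.
  rewrite {1}(matrix_sum_delta M) mulmx_sumr dgram_sum linear_sum.
  apply: eq_bigr => i _; rewrite mulmx_sumr dgram_sum linear_sum.
  by apply: eq_bigr => j _; rewrite -scalemxAr dgramZ linearZ.
have w00 := w0 _ _ TVM; exists L, (M + M^T); split => //.
- by rewrite linearD /= trmxK addrC.
- case: wM => [|M0]; first by rewrite w00 eqxx.
  apply: contraNneq M0 => /matrixP MT; apply/eqP/matrixP => i j; rewrite [RHS]mxE.
  have := MT i j; rewrite !mxE => Mij.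
  case: (ltngtP i j) => [/Mlow//|/Mlow ij|/val_inj ij].
    by rewrite ij addr0 in Mij.
  by move: Mij; rewrite ij -mulr2n => /eqP; rewrite mulrn_eq0 => /eqP.
move=> H HE; suff -> : H = dgram V (V *m M) by move: TVM; rewrite w00 mulmx0 addr0.
apply: val_inj; rewrite /= HE mulmxDr mulmxDl trmx_mul !mulmxA addrC.
by [].
Qed.

(** If [L] is a left inverse of [V], then [L^T (1 + s N)^-1 L] is a generalized
    inverse of [V (1 + s N) V^T], bounded independently of small [s]. *)
Lemma indefinite_slack_segment b C V y (z : 'cV[R]_n) :
  let S : symmx R n := C - adj A y in
  (m < (p * p.+1) %/ 2 + p)%N ->
  A (gram V) = b ->
  symval S *m V = 0 ->
  (forall U, bm_tangent A V U -> 0 <= frob U (symval S *m U)) ->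
  (z^T *m S *m z) 0 0 < 0 ->
  exists k e (X H : symmx R n),
    [/\ 0 < e, H != 0 & forall s, `|s| <= e -> complementary A b k C (X + s *: H)].
Proof.
move=> S mp AV SV hess zSz.
have [L [N [LV sN N0 AN]]] := indefinite_slack_direction mp SV hess zSz.
have [e e0 Ge] := perturb_identity_inv sN.
have HP : V *m N *m V^T \in @is_symmx R n.
  by rewrite unfold_in !trmx_mul trmxK sN mulmxA.
pose H := Symmx HP.
have VL : V^T *m L^T = 1%:M by rewrite -trmx_mul LV trmx1.
have HE s : symval (gram V + s *: H) = V *m (1%:M + s *: N) *m V^T.
  by rewrite symmx_addE symmx_scaleE /= mulmxDr mulmx1 mulmxDl -scalemxAr -scalemxAl.
pose l := frob L L + 1.
have l0 : 0 <= l by rewrite addr_ge0// frob_ge0.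
pose kY := p%:R * (p%:R * (l * (2 * l))).
pose kS := frob S S + 1.
exists (kS + kY), e, (gram V), H; split=> // [|s /Ge[uG bG]].
  apply: contraNneq N0 => /(congr1 (@symval R n)) /= H0.
  have : L *m (V *m N *m V^T) *m L^T = 0 by rewrite H0 mulmx0 mul0mx.
  by rewrite !mulmxA LV mul1mx -mulmxA VL mulmx1 => ->.
split; first by rewrite linearD linearZ /= AV (AN H) ?scaler0 ?addr0.
pose G := 1%:M + s *: N; exists S, (L^T *m invmx G *m L).
have kS0 : 0 <= kS by rewrite addr_ge0// frob_ge0.
have kY0 : 0 <= kY by rewrite !mulr_ge0.
split.
- move=> Z AZ; rewrite symmx_subE opprB addrC subrK frob_adj AZ.
  by rewrite mulmx0 mxE.
- by rewrite HE !mulmxA SV !mul0mx.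
- rewrite HE -/G.
  transitivity (V *m G *m (V^T *m L^T) *m invmx G *m (L *m V) *m G *m V^T).
    by rewrite !mulmxA.
  by rewrite VL LV !mulmx1 mulmxK.
split=> i j.
  by apply: (le_trans (entries_bounded_by_frob _ _ _)); rewrite lerDl.
rewrite -mulmxA; apply: (@le_trans _ _ kY); last by rewrite lerDr.
rewrite mxE; apply: normr_sum_le_const => u.
rewrite !mxE mulr_sumr; apply: normr_sum_le_const => v.
have bL := entries_bounded_by_frob L.
by rewrite normrM ler_pM// ?bL// normrM ler_pM// ?bL.
Qed.

(** Weak duality: [<C, X> = <S, X> + <y, b>] on the feasible set. *)
Lemma psd_slack_optimal b C V y : let S : symmx R n := C - adj A y in
  A (gram V) = b -> symval S *m V = 0 -> psdmx S ->
  global_minimizer (sdp_cost C) (sdp_feasible A b) (gram V).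
Proof.
move=> S AV SV pS; split=> [|X [AX pX]]; first by split=> //; exact: psd_gram.
have SE (Z : symmx R n) : A Z = b -> sdp_cost C Z = frob S Z + (y^T *m b) 0 0.
  by move=> <-; rewrite symmx_subE frobBl frob_adj subrK.
rewrite !SE// lerD2r; have -> : frob S (gram V) = 0.
  by rewrite frob_symmx_gram SV frob0l.
exact: frob_psd_ge0.
Qed.

End Segment.

Theorem theorem1 (R : realType) (n m p : nat)
    (n_gt0 : (0 < n)%N) (m_gt0 : (0 < m)%N) (p_gt0 : (0 < p)%N)
    (A : {linear symmx R n -> 'cV[R]_m}) (b : 'cV[R]_m)
    (compactC : compact (@symval R n @` sdp_feasible A b))
    (regularA : p_regular A b p)
    (mp : (m < (p * p.+1) %/ 2 + p)%N) :
  almost_all_symmx (fun C : symmx R n =>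
    forall V : 'M[R]_(n, p), second_order_critical A b C V ->
      global_minimizer (bm_cost C) (bm_feasible A b (p := p)) V /\
      global_minimizer (sdp_cost C) (sdp_feasible A b) (gram V)).
Proof.
apply: (@complementary_segment_null _ _ _ A b) => // C.
move=> /existsNP[V /not_implyP[crit nopt]].
have AV : A (gram V) = b by case: crit.
have [y [SV hess]] := second_order_critical_slack regularA crit.
have [z zSz] : exists z : 'cV[R]_n, (z^T *m (C - adj A y : symmx R n) *m z) 0 0 < 0.
  apply: contrapT => nz; apply: nopt.
  have pS : psdmx (C - adj A y : symmx R n).
    by move=> z; rewrite leNgt; apply/negP => zSz; apply: nz; exists z.
  have Vopt := psd_slack_optimal AV SV pS; split=> //; split=> // W AW.
  by apply: Vopt.2; split=> //; exact: psd_gram.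
exact: (indefinite_slack_segment mp AV SV hess zSz).
Qed.
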